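(* Let $\underline{M}\in\mathfrak{M}$. Then the isentrope function $\Psi_{\underline{M}}:(\alpha_1(\underline{M}),\alpha_2(\underline{M}))\to(0,1]$ is differentiable at every point of $(\alpha_1(\underline{M}),\alpha_2(\underline{M}))$, and its derivative $\Psi'_{\underline{M}}$ is continuous on $(\alpha_1(\underline{M}),\alpha_2(\underline{M}))$.
   Context: For $0<\alpha<1$ and $0\le\beta\le1$ the skew tent map $T_{\alpha,\beta}:[0,1]\to[0,1]$ is $T_{\alpha,\beta}(x)=\frac{\beta}{\alpha}x$ for $0\le x\le\alpha$ and $T_{\alpha,\beta}(x)=\frac{\beta}{1-\alpha}(1-x)$ for $\alpha<x\le1$. Let $U=\{(\alpha,\beta): \tfrac12<\beta\le1,\ 1-\beta<\alpha<\beta\}$. For $(\alpha,\beta)\in U$ the extended kneading sequence $(\mathfrak m_1,\mathfrak m_2,\dots)\in\{L,C,R\}^{\mathbb N}$ is defined by $\mathfrak m_n=L$, $C$ or $R$ according as $T^n_{\alpha,\beta}(\alpha)<\alpha$, $=\alpha$ or $>\alpha$. The kneading sequence $K(\alpha,\beta)$ is the extended kneading sequence if it contains no $C$, and otherwise is the finite string obtained by stopping at the first $C$. Let $\mathfrak M=\{K(\alpha,\beta):(\alpha,\beta)\in U\}$. It is known (Misiurewicz–Visinescu) that for each $\underline M\in\mathfrak M$ there exist numbers $\alpha_1(\underline M)<\alpha_2(\underline M)$ and a continuous function $\Psi_{\underline M}$ on $(\alpha_1(\underline M),\alpha_2(\underline M))$ with $(\alpha,\Psi_{\underline M}(\alpha))\in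 U$ such that for $(\alpha,\beta)\in U$ one has $K(\alpha,\beta)=\underline M$ if and only if $\alpha\in(\alpha_1(\underline M),\alpha_2(\underline M))$ and $\beta=\Psi_{\underline M}(\alpha)$. The graph of $\Psi_{\underline M}$ is called the isentrope of $\underline M$. *)

(* Defs.v *)
From Stdlib Require Import Reals.
Open Scope R_scope.

Definition skew_tent (a b x : R) : R :=
  if Rle_dec x a then b / a * x else b / (1 - a) * (1 - x).

Fixpoint tent_iter (n : nat) (a b x : R) : R :=
  match n with
  | O => x
  | S k => skew_tent a b (tent_iter k a b x)
  end.

Definition inU (a b : R) : Prop := 1/2 < b <= 1 /\ 1 - b < a < b.

Inductive sym : Set := L | C | R_.

(* Extended kneading sequence: m_n for n >= 1 (the value at n = 0 is
   irrelevant and not used by the kneading sequence below). *)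
Definition ext_kneading (a b : R) (n : nat) : sym :=
  match total_order_T (tent_iter n a b a) a with
  | inleft (left _) => L
  | inleft (right _) => C
  | inright _ => R_
  end.

Definition isC (s : sym) : bool := match s with C => true | _ => false end.

Fixpoint noC_upto (m : nat -> sym) (n : nat) : bool :=
  match n with
  | O => true
  | S k => noC_upto m k && negb (isC (m (S k)))
  end.

(* Kneading sequence, encoded as a function: K n = Some m_n for n >= 1
   as long as no C occurred among m_1..m_{n-1} (so the first C is kept),
   and None afterwards (end of the finite string); K 0 = None. *)
Definition kneading (a b : R) : nat -> option sym :=
  fun n => match n with
           | O => None
           | S k => if noC_upto (ext_kneading a b) k
                    then Some (ext_kneading a b (S k)) else None
           end.

(* Main.v *)
Require Import Defs.
From Stdlib Require Import Reals Lra Lia Compare_dec.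
From Coquelicot Require Import Coquelicot.
Open Scope R_scope.

(** Put [t = 1/b] and let [r_n] be [0] or [1] according to the side of [a] on
    which [T^(n+1)(a)] lies.  The inverse branches of [T] have slopes
    [t (a - r_n)], and pulling the turning point back along its own orbit gives
    [F(a,t) = sum_n t^n prod_(j<n) (a - r_j) = 0].  The series depends on the
    kneading sequence only, so the isentrope lies in the zero set of one analytic
    function, and what has to be shown is that [F_t <> 0] on it.

    Let [g_n] be the (left) density at [a] of the image under [T^n] of Lebesgue
    measure.  These densities are combinations of indicators of the intervals
    [[0, T^j(a)]], which yields a renewal equation, that is
    [(sum_n g_n s^n) (1 - s a/b) F(a, s/b) = 1].  As the total mass is [1], the
    sequence [g_n] is bounded, whence [F(a,t) >= K (1/b - t)] for [0 <= t < 1/b].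
    Thus [1/b] is the smallest zero of [F(a,.)] and it is simple; minimality makes
    [1/Psi] continuous and simplicity makes it of class C^1. *)

(** * Critical orbit, kneading products and densities *)

Definition orbit (a b : R) (n : nat) : R := tent_iter (S n) a b a.

(* The turning point itself counts as lying on the right: a [C] is read as [R_]. *)
Definition right_of (a x : R) : R := if Rle_dec a x then 1 else 0.

Fixpoint kprod (r : nat -> R) (a : R) (n : nat) : R :=
  match n with
  | O => 1
  | S k => kprod r a k * (a - r k)
  end.

(* Distribution function on [[0,1]] of the image of Lebesgue measure under [T^n]. *)
Fixpoint cdf (a b : R) (n : nat) (x : R) : R :=
  match n with
  | O => x
  | S k => cdf a b k (a * (Rmin x b / b)) + 1
           - cdf a b k (1 - (1 - a) * (Rmin x b / b))
  end.

(* [coef r a (1/b) n j] is the weight of [x |-> Rmin x (T^(j+1)(a))] in [cdf a b (S n)];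
   see [cdf_step_sum]. *)
Fixpoint coef (r : nat -> R) (a t : R) (n j : nat) : R :=
  match n, j with
  | O, O => t
  | O, S _ => 0
  | S m, O => t * sum_f_R0 (fun i => coef r a t m i * r i) m
  | S m, S i => t * (a - r i) * coef r a t m i
  end.

(* The left derivative at [a] of [cdf a b n] (for [t = 1/b]). *)
Definition crit_density (r : nat -> R) (a t : R) (n : nat) : R :=
  match n with
  | O => 1
  | S m => sum_f_R0 (fun i => coef r a t m i * r i) m
  end.

(** * One step of the tent map *)

Lemma Rmin_cases x y : (x <= y /\ Rmin x y = x) \/ (y <= x /\ Rmin x y = y).
Proof.
  destruct (Rle_dec x y) as [H|H].
  - left; split; [exact H | now apply Rmin_left].
  - right; split; [lra | apply Rmin_right; lra].
Qed.

Lemma right_of_01 a x : right_of a x = 0 \/ right_of a x = 1.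
Proof. unfold right_of; destruct (Rle_dec a x); auto. Qed.

Lemma skew_tent_range a b x :
  inU a b -> 0 <= x <= 1 -> 0 <= skew_tent a b x <= b.
Proof.
  intros [Hb Ha] Hx; unfold skew_tent.
  destruct (Rle_dec x a) as [H|H].
  - replace (b / a * x) with (b * (x / a)) by (field; lra).
    assert (0 <= x / a) by (apply Rdiv_le_0_compat; lra).
    assert (x / a <= 1) by (apply Rle_div_l; lra).
    split; nra.
  - replace (b / (1 - a) * (1 - x)) with (b * ((1 - x) / (1 - a))) by (field; lra).
    assert (0 <= (1 - x) / (1 - a)) by (apply Rdiv_le_0_compat; lra).
    assert ((1 - x) / (1 - a) <= 1) by (apply Rle_div_l; lra).
    split; nra.
Qed.

Lemma orbit_0 a b : inU a b -> orbit a b 0 = b.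
Proof.
  intros [Hb Ha]; unfold orbit, tent_iter, skew_tent.
  destruct (Rle_dec a a); [field; lra | lra].
Qed.

Lemma orbit_S a b n : orbit a b (S n) = skew_tent a b (orbit a b n).
Proof. reflexivity. Qed.

Lemma orbit_range a b n : inU a b -> 0 <= orbit a b n <= b.
Proof.
  intros HU; induction n as [|n IH].
  - rewrite (orbit_0 _ _ HU); destruct HU; lra.
  - rewrite orbit_S; apply skew_tent_range; auto.
    destruct HU; lra.
Qed.

(** Both branches are affine through [(a, b)], with slope [b / (a - r)] for [r = 0] on the left and
    [r = 1] on the right. At [x = a] both sides vanish. *)
Lemma skew_tent_inverse_branch a b x :
  inU a b -> / b * (a - right_of a x) * (skew_tent a b x - b) = x - a.
Proof.
  intros [Hb Ha]; unfold skew_tent, right_of.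
  destruct (Rle_dec x a) as [H|H]; destruct (Rle_dec a x) as [H'|H']; try lra.
  - replace x with a by lra. field. lra.
  - field; lra.
  - field; lra.
Qed.

(* The left side is the image under one step of [cdf] of the distribution function
   [x |-> Rmin x z]; for [z >= a] this creates a new jump at the maximum [b]. *)
Lemma skew_tent_cdf a b x z :
  inU a b -> 0 <= x <= 1 -> 0 <= z <= 1 ->
  Rmin (a * (Rmin x b / b)) z + z - Rmin (1 - (1 - a) * (Rmin x b / b)) z
  = / b * (a - right_of a z) * Rmin x (skew_tent a b z)
    + / b * right_of a z * Rmin x b.
Proof.
  intros HU Hx Hz.
  pose proof (skew_tent_range a b z HU Hz) as HT.
  assert (Hm : Rmin x (skew_tent a b z) = Rmin (Rmin x b) (skew_tent a b z)).
  { rewrite <- Rmin_assoc. f_equal. symmetry; apply Rmin_right; lra. }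
  rewrite Hm. clear Hm.
  assert (Hy : 0 <= Rmin x b / b <= 1).
  { destruct HU. split; [apply Rdiv_le_0_compat | apply Rle_div_l]; try lra.
    - apply Rmin_glb; lra.
    - rewrite Rmult_1_l; apply Rmin_r. }
  remember (Rmin x b / b) as y eqn:Ey.
  assert (Ey' : Rmin x b = b * y) by (subst y; destruct HU; field; lra).
  rewrite Ey'. clear Ey Ey'.
  destruct HU as [Hb Ha]. revert HT. unfold skew_tent, right_of.
  destruct (Rle_dec a z) as [H|H].
  - assert (Hs : (if Rle_dec z a then b / a * z else b / (1 - a) * (1 - z))
            = b * ((1 - z) / (1 - a))).
    { destruct (Rle_dec z a); [replace z with a by lra; field; lra | field; lra]. }
    rewrite Hs; intros _.
    (* Here [T(z) = b * q], so comparing [y] with [q] settles both remaining minima; the other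
       branch is treated alike. *)
    remember ((1 - z) / (1 - a)) as q eqn:Eq.
    assert (Ez : z = 1 - (1 - a) * q) by (subst q; field; lra).
    rewrite Ez.
    assert (a * y <= 1 - (1-a)*q) by (rewrite <- Ez; nra).
    rewrite (Rmin_left (a * y)) by auto.
    destruct (Rle_dec y q) as [h|h].
    + rewrite (Rmin_right (1 - (1-a)*y)) by nra.
      rewrite (Rmin_left (b * y)) by nra. field; lra.
    + rewrite (Rmin_left (1 - (1-a)*y)) by nra.
      rewrite (Rmin_right (b * y)) by nra. field; lra.
  - destruct (Rle_dec z a); [|lra]. intros _.
    rewrite (Rmin_right (1 - (1-a)*y)) by nra.
    replace (b / a * z) with (b * (z / a)) by (field; lra).
    remember (z / a) as q eqn:Eq.
    assert (Ez : z = a * q) by (subst q; field; lra).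
    rewrite Ez.
    destruct (Rle_dec y q) as [h|h].
    + rewrite (Rmin_left (a * y)) by nra.
      rewrite (Rmin_left (b * y)) by nra. field; lra.
    + rewrite (Rmin_right (a * y)) by nra.
      rewrite (Rmin_right (b * y)) by nra. field; lra.
Qed.

(** * Images of Lebesgue measure *)

Lemma cdf_monotone a b n :
  inU a b ->
  cdf a b n 0 = 0 /\ cdf a b n 1 = 1 /\
  (forall x y, 0 <= x -> x <= y -> y <= 1 -> cdf a b n x <= cdf a b n y).
Proof.
  intros HU; induction n as [|n (I0 & I1 & IH)]; [simpl; auto with real|].
  assert (Hb : 0 < b <= 1 /\ 0 < a < 1) by (destruct HU; lra).
  split; [|split]; simpl.
  - rewrite Rmin_left by lra.
    replace (a * (0 / b)) with 0 by (field; lra).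
    replace (1 - (1 - a) * (0 / b)) with 1 by (field; lra). lra.
  - rewrite Rmin_right by lra.
    replace (b / b) with 1 by (field; lra).
    replace (1 - (1 - a) * 1) with (a * 1) by ring. lra.
  (* The preimage of [[0,x]] is [[0, a*u]] together with [[1 - (1-a)*u, 1]], where
     [u = Rmin x b / b]; both intervals grow with [x]. *)
  - intros x y Hx Hxy Hy.
    assert (H1 : 0 <= Rmin x b / b).
    { apply Rdiv_le_0_compat; [apply Rmin_glb|]; lra. }
    assert (H2 : Rmin x b / b <= Rmin y b / b).
    { apply Rmult_le_compat_r; [left; apply Rinv_0_lt_compat; lra|].
      apply Rle_min_compat_r; auto. }
    assert (H3 : Rmin y b / b <= 1).
    { apply Rle_div_l; [lra|]. rewrite Rmult_1_l; apply Rmin_r. }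
    assert (cdf a b n (a * (Rmin x b / b)) <= cdf a b n (a * (Rmin y b / b)))
      by (apply IH; nra).
    assert (cdf a b n (1 - (1-a) * (Rmin y b / b)) <= cdf a b n (1 - (1-a) * (Rmin x b / b)))
      by (apply IH; nra).
    lra.
Qed.

(** [skew_tent_cdf] applies termwise: the weight at index [j] moves to index [j+1], and all points
    on the right of [a] together feed index [0], the maximum [b]. *)
Lemma cdf_step_sum a b n x :
  inU a b -> 0 <= x <= 1 ->
  cdf a b (S n) x =
  sum_f_R0 (fun j => coef (fun i => right_of a (orbit a b i)) a (/ b) n j
                     * Rmin x (orbit a b j)) n.
Proof.
  intros HU; revert x; set (r := fun i => right_of a (orbit a b i)).
  assert (Hb : 0 < b <= 1 /\ 0 < a < 1) by (destruct HU; lra).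
  induction n as [|n IH]; intros x Hx.
  - simpl sum_f_R0. rewrite (orbit_0 _ _ HU). simpl. field. lra.
  - assert (Hy : 0 <= Rmin x b / b <= 1).
    { split; [apply Rdiv_le_0_compat | apply Rle_div_l]; try lra.
      - apply Rmin_glb; lra.
      - rewrite Rmult_1_l; apply Rmin_r. }
    change (cdf a b (S (S n)) x) with
      (cdf a b (S n) (a * (Rmin x b / b)) + 1 - cdf a b (S n) (1 - (1 - a) * (Rmin x b / b))).
    destruct (cdf_monotone a b (S n) HU) as (_ & E1 & _).
    (* The total mass [1] is written as [cdf a b (S n) 1], so that all three terms expand into sums
       over the same points. *)
    transitivity (cdf a b (S n) (a * (Rmin x b / b)) + cdf a b (S n) 1
                  - cdf a b (S n) (1 - (1 - a) * (Rmin x b / b))); [lra|].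
    rewrite !IH by nra.
    rewrite <- sum_plus, <- minus_sum.
    rewrite (decomp_sum _ (S n)) by lia. simpl pred.
    rewrite (orbit_0 _ _ HU).
    change (coef r a (/ b) (S n) 0) with
      (/ b * sum_f_R0 (fun i => coef r a (/b) n i * r i) n).
    rewrite Rmult_assoc, (Rmult_comm (sum_f_R0 _ _)), <- Rmult_assoc, scal_sum, <- sum_plus.
    apply sum_eq. intros i _.
    pose proof (orbit_range a b i HU) as Ho.
    pose proof (skew_tent_cdf a b x (orbit a b i) HU Hx ltac:(lra)) as Hc.
    rewrite (Rmin_right 1) by lra.
    change (coef r a (/ b) (S n) (S i)) with (/ b * (a - r i) * coef r a (/b) n i).
    rewrite orbit_S.
    transitivity (coef r a (/ b) n i *
       (Rmin (a * (Rmin x b / b)) (orbit a b i) + orbit a b i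
        - Rmin (1 - (1 - a) * (Rmin x b / b)) (orbit a b i))); [ring|].
    rewrite Hc. unfold r. ring.
Qed.

(** A jump of index [j] was created [j] steps earlier with weight [t * crit_density r a t (n - j)]
    and has gained one factor [t * (a - r i)] per step since. This turns the recursion for the
    densities into a renewal equation. *)
Lemma coef_eq r a t n j :
  (j <= n)%nat ->
  coef r a t n j = t * crit_density r a t (n - j) * (t ^ j * kprod r a j).
Proof.
  revert j; induction n as [|n IH]; intros j Hj.
  - replace j with O by lia. simpl. ring.
  - destruct j as [|j]; [simpl; ring|].
    change (coef r a t (S n) (S j)) with (t * (a - r j) * coef r a t n j).
    rewrite IH by lia. simpl. ring.
Qed.

(** * Boundedness of the densities at the turning point *)

Lemma kprod_bound r a p n :
  0 <= p -> (forall k, Rabs (a - r k) <= p) -> Rabs (kprod r a n) <= p ^ n.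
Proof.
  intros Hp Hr; induction n as [|n IH]; simpl.
  - rewrite Rabs_R1; lra.
  - rewrite Rabs_mult, Rmult_comm.
    apply Rmult_le_compat; auto using Rabs_pos.
Qed.

(** Of finitely many points, those below [a] keep a positive distance from it, so on [[a-d, a]] each
    [Rmin x (z j)] is affine with slope [0] or [1]. *)
Lemma left_gap (z : nat -> R) a N :
  0 < a ->
  exists d, 0 < d <= a /\
    forall j, (j <= N)%nat -> Rmin a (z j) - Rmin (a - d) (z j) = d * right_of a (z j).
Proof.
  intros Ha.
  assert (H : exists d, 0 < d <= a /\
    forall j, (j <= N)%nat -> z j < a -> z j <= a - d).
  { induction N as [|N (d & Hd & IH)].
    - destruct (Rlt_dec (z 0%nat) a).
      + exists (Rmin a (a - z 0%nat)). split.
        * split; [apply Rmin_glb_lt; lra | apply Rmin_l].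
        * intros j Hj _. replace j with O by lia.
          pose proof (Rmin_r a (a - z 0%nat)). lra.
      + exists a. split; [lra|]. intros j Hj. replace j with O by lia. lra.
    - destruct (Rlt_dec (z (S N)) a).
      + exists (Rmin d (a - z (S N))). split.
        * split; [apply Rmin_glb_lt; lra|].
          pose proof (Rmin_l d (a - z (S N))); lra.
        * intros j Hj Hz.
          pose proof (Rmin_l d (a - z (S N))).
          pose proof (Rmin_r d (a - z (S N))).
          destruct (Nat.eq_dec j (S N)) as [->|]; [lra|].
          specialize (IH j ltac:(lia) Hz). lra.
      + exists d. split; [lra|]. intros j Hj Hz.
        destruct (Nat.eq_dec j (S N)) as [->|]; [lra|]. apply IH; auto; lia. }
  destruct H as (d & Hd & H). exists d; split; auto.
  intros j Hj. unfold right_of. destruct (Rle_dec a (z j)).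
  - rewrite !Rmin_left by lra. ring.
  - specialize (H j Hj ltac:(lra)). rewrite !Rmin_right by lra. ring.
Qed.

(** Membership in [U] gives [a < b] and [1 - a < b]: both inverse branches contract. *)
Lemma contraction a b (r : nat -> R) :
  inU a b -> (forall k, r k = 0 \/ r k = 1) ->
  0 < Rmax a (1 - a) /\ / b * Rmax a (1 - a) < 1 /\
  forall k, Rabs (a - r k) <= Rmax a (1 - a).
Proof.
  intros [Hb Ha] Hr. pose proof (Rmax_l a (1 - a)). pose proof (Rmax_r a (1 - a)).
  split; [lra|]. split.
  - apply Rmult_lt_reg_l with b; [lra|].
    rewrite <- Rmult_assoc, Rinv_r, Rmult_1_l, Rmult_1_r by lra.
    apply Rmax_lub_lt; lra.
  - intros k. apply Rabs_le. destruct (Hr k) as [-> | ->]; lra.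
Qed.

(** The [Nat.max] covers [n <= J], where no term survives and the two powers cancel. *)
Lemma geometric_tail_sum q J n :
  sum_f_R0 (fun j => if le_dec j J then 0 else q ^ j) n * (1 - q)
  = q ^ S J - q ^ S (Nat.max n J).
Proof.
  induction n as [|n IH].
  - simpl sum_f_R0. destruct (le_dec 0 J); [|lia].
    rewrite Nat.max_r by lia. ring.
  - simpl sum_f_R0. rewrite Rmult_plus_distr_r, IH.
    destruct (le_dec (S n) J).
    + rewrite !Nat.max_r by lia. ring.
    + rewrite !Nat.max_l by lia. simpl. ring.
Qed.

(** The sum is the mass that the image of Lebesgue measure under [T^(n+1)] gives to [(a-d, a]]. *)
Lemma crit_density_increment a b n d :
  inU a b -> 0 < d <= a ->
  0 <= sum_f_R0 (fun j => coef (fun i => right_of a (orbit a b i)) a (/ b) n j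
                     * (Rmin a (orbit a b j) - Rmin (a - d) (orbit a b j))) n <= 1.
Proof.
  intros HU Hd.
  assert (Ha : 0 < a < 1) by (destruct HU; lra).
  destruct (cdf_monotone a b (S n) HU) as (E0 & E1 & Hm).
  assert (E : cdf a b (S n) a - cdf a b (S n) (a - d) =
    sum_f_R0 (fun j => coef (fun i => right_of a (orbit a b i)) a (/ b) n j
                     * (Rmin a (orbit a b j) - Rmin (a - d) (orbit a b j))) n).
  { rewrite !cdf_step_sum by (auto; lra). rewrite <- minus_sum.
    apply sum_eq. intros; ring. }
  rewrite <- E.
  assert (cdf a b (S n) (a - d) <= cdf a b (S n) a) by (apply Hm; lra).
  assert (cdf a b (S n) a <= cdf a b (S n) 1) by (apply Hm; lra).
  assert (cdf a b (S n) 0 <= cdf a b (S n) (a - d)) by (apply Hm; lra).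
  lra.
Qed.

(** For [d] small, depending on [n], the mass of [(a-d, a]] is exactly [d] times the density. *)
Lemma crit_density_nonneg a b n :
  inU a b -> 0 <= crit_density (fun i => right_of a (orbit a b i)) a (/ b) n.
Proof.
  intros HU. destruct n as [|n]; simpl; [lra|].
  destruct (left_gap (orbit a b) a n) as (d & Hd & H); [destruct HU; lra|].
  pose proof (proj1 (crit_density_increment a b n d HU Hd)) as Hi.
  rewrite (sum_eq _ (fun j => coef (fun i => right_of a (orbit a b i)) a (/ b) n j
       * right_of a (orbit a b j) * d)) in Hi.
  2:{ intros j Hj; rewrite H by exact Hj; ring. }
  rewrite <- scal_sum in Hi. nra.
Qed.

(* Jumps after time [J] are exponentially small and the earlier ones avoid a fixed
   left neighbourhood of [a], so on it the density is at least [g_(n+1) - B/2];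
   the mass there being at most [1], the bound [B] propagates. *)
Lemma crit_density_bounded a b :
  inU a b -> exists B, 0 < B /\
    forall n, crit_density (fun i => right_of a (orbit a b i)) a (/ b) n <= B.
Proof.
  intros HU. set (r := fun i => right_of a (orbit a b i)).
  destruct (contraction a b r HU) as (Hp & Hq & Hk).
  { intros k; apply right_of_01. }
  assert (Hb : 0 < / b) by (apply Rinv_0_lt_compat; destruct HU; lra).
  set (p := Rmax a (1 - a)) in *. set (q := / b * p) in *.
  assert (Hq0 : 0 < q) by (unfold q; nra).
  (* [J] makes the geometric tail [q^(J+1) / (1-q)] smaller than [b/2]; after multiplication by
     [/ b * B] it costs at most [B/2]. *)
  destruct (pow_lt_1_zero q ltac:(rewrite Rabs_right; lra) ((1 - q) * b / 2)) as (J & HJ).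
  { assert (0 < b) by (destruct HU; lra). nra. }
  specialize (HJ (S J) ltac:(lia)). rewrite Rabs_right in HJ by (apply Rle_ge, pow_le; lra).
  destruct (left_gap (orbit a b) a J) as (d & Hd & H); [destruct HU; lra|].
  assert (Hd2 : 0 < 2 / d) by (apply Rdiv_lt_0_compat; lra).
  pose proof (Rmax_l 1 (2 / d)) as HB1. pose proof (Rmax_r 1 (2 / d)) as HB2.
  (* The [1] covers [g_0 = 1]; the [2/d] closes the induction, since the mass bound gives
     [g_(n+1) - B/2 <= 1/d <= B/2]. *)
  set (B := Rmax 1 (2 / d)) in *. exists B. split; [lra|].
  intros n; induction n as [n IH] using (well_founded_induction Wf_nat.lt_wf).
  destruct n as [|n]; [simpl; lra|].
  pose proof (proj2 (crit_density_increment a b n d HU Hd)) as Hi. fold r in Hi.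
  assert (Hlow : sum_f_R0 (fun j => coef r a (/ b) n j * r j * d) n
     - sum_f_R0 (fun j => (if le_dec j J then 0 else q ^ j) * (/ b * B * d)) n <= 1).
  { eapply Rle_trans; [|exact Hi]. rewrite <- minus_sum. apply sum_Rle.
    intros j Hj. destruct (le_dec j J) as [h|h].
    - rewrite H by exact h. unfold r. lra.
    (* For late jumps [e] and [r j * d] may differ, but both lie in [[0,d]], so exchanging them
       costs at most [d] times the weight. *)
    - set (e := Rmin a (orbit a b j) - Rmin (a - d) (orbit a b j)).
      assert (He : 0 <= e <= d).
      { unfold e. destruct (Rmin_cases a (orbit a b j)) as [[? ->]|[? ->]];
        destruct (Rmin_cases (a - d) (orbit a b j)) as [[? ->]|[? ->]]; lra. }
      assert (Hc : Rabs (coef r a (/ b) n j) <= / b * B * q ^ j).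
      { rewrite coef_eq by exact Hj. rewrite Rabs_mult. apply Rmult_le_compat; try apply Rabs_pos.
        - rewrite Rabs_mult, !Rabs_right; try lra.
          + apply Rmult_le_compat_l; [lra|]. apply IH; lia.
          + apply Rle_ge, crit_density_nonneg, HU.
        - rewrite Rabs_mult. unfold q. rewrite Rpow_mult_distr.
          rewrite (Rabs_right ((/ b) ^ j)) by (apply Rle_ge, pow_le; lra).
          apply Rmult_le_compat_l; [apply pow_le; lra|].
          apply kprod_bound; auto; lra. }
      assert (Hx : Rabs (r j * d - e) <= d).
      { apply Rabs_le. unfold r. destruct (right_of_01 a (orbit a b j)) as [-> | ->]; lra. }
      assert (Hm : Rabs (coef r a (/ b) n j * (r j * d - e)) <= / b * B * q ^ j * d).
      { rewrite Rabs_mult. apply Rmult_le_compat; auto using Rabs_pos. }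
      pose proof (Rle_abs (coef r a (/ b) n j * (r j * d - e))). nra. }
  rewrite <- !scal_sum in Hlow.
  change (sum_f_R0 (fun i => coef r a (/ b) n i * r i) n) with (crit_density r a (/ b) (S n)) in Hlow.
  pose proof (geometric_tail_sum q J n) as Hg.
  set (S0 := sum_f_R0 (fun j => if le_dec j J then 0 else q ^ j) n) in *.
  assert (HS : / b * S0 <= / 2).
  { pose proof (pow_lt q (S (Nat.max n J)) Hq0).
    assert (Hs : S0 < b / 2).
    { apply Rmult_lt_reg_r with (1 - q); [lra|]. rewrite Hg. nra. }
    replace (/ 2) with (/ b * (b / 2)) by (field; destruct HU; lra).
    apply Rmult_le_compat_l; lra. }
  assert (Hg2 : crit_density r a (/ b) (S n) - B / 2 <= / d).
  { apply Rmult_le_reg_l with d; [lra|]. rewrite Rinv_r by lra.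
    assert (d * B * (/ b * S0) <= d * B * / 2) by (apply Rmult_le_compat_l; nra).
    lra. }
  unfold Rdiv in HB2. lra.
Qed.

(** * Renewal equation and the smallest zero of the kneading series *)

Lemma ex_series_Rabs_le (f M : nat -> R) :
  (forall n, Rabs (f n) <= M n) -> ex_series M -> ex_series (fun n => Rabs (f n)).
Proof.
  intros H HM.
  apply (@ex_series_le R_AbsRing R_CompleteNormedModule _ M); [|exact HM].
  intros n. change (Rabs (Rabs (f n)) <= M n). now rewrite Rabs_Rabsolu.
Qed.

(** The recursion says that the generating functions satisfy [E * G = 1], and [0 <= g n <= B] gives
    [0 <= G <= B / (1-s)]. *)
Lemma renewal_lower_bound (e g : nat -> R) (B s : R) :
  e O = 1 -> g O = 1 ->
  (forall m, g (S m) = - sum_f_R0 (fun j => e (S j) * g (m - j)%nat) m) ->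
  0 < B -> (forall n, 0 <= g n <= B) -> 0 <= s < 1 ->
  ex_series (fun n => Rabs (e n * s ^ n)) ->
  (1 - s) / B <= Series (fun n => e n * s ^ n).
Proof.
  intros He Hg Hrec HB Hgb Hs Hex.
  assert (Hgeo : is_series (fun n => s ^ n) (/ (1 - s))).
  { apply is_series_geom. rewrite Rabs_right; lra. }
  assert (HgeoB : is_series (fun n => B * s ^ n) (B * / (1 - s))).
  { apply (is_series_scal B (fun n => s ^ n)), Hgeo. }
  assert (Hb : forall n, 0 <= g n * s ^ n <= B * s ^ n).
  { intros n. destruct (Hgb n). pose proof (pow_le s n ltac:(lra)).
    split; [nra | apply Rmult_le_compat_r; auto]. }
  assert (Hexg : ex_series (fun n => Rabs (g n * s ^ n))).
  { apply (ex_series_Rabs_le _ (fun n => B * s ^ n)); [|eexists; apply HgeoB].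
    intros n. rewrite Rabs_right; [apply Hb | apply Rle_ge, Hb]. }
  pose proof (is_series_mult _ _ _ _ (Series_correct _ (ex_series_Rabs _ Hex))
                (Series_correct _ (ex_series_Rabs _ Hexg)) Hex Hexg) as Hmul.
  (* The Cauchy product has constant term [1], and the recursion kills all its other
     coefficients. *)
  assert (H1 : is_series (fun n => sum_f_R0 (fun k => e k * s ^ k * (g (n - k)%nat * s ^ (n - k))) n) 1).
  { apply (is_series_ext (fun n => match n with O => 1 | S _ => 0 end)).
    - intros [|n].
      + simpl. rewrite He, Hg. ring.
      + rewrite decomp_sum by lia. simpl pred.
        rewrite He, Nat.sub_0_r, Hrec.
        rewrite (sum_eq (fun j => e (S j) * s ^ S j * _)
                   (fun j => e (S j) * g (n - j)%nat * s ^ S n)).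
        * rewrite <- (scal_sum (fun j => e (S j) * g (n - j)%nat)). simpl. ring.
        * intros j Hj. replace (S n - S j)%nat with (n - j)%nat by lia.
          assert (Hpow : s ^ S n = s ^ S j * s ^ (n - j)) by (rewrite <- pow_add; f_equal; lia).
          rewrite Hpow. ring.
    - change (is_lim_seq (sum_n (fun n => match n with O => 1 | S _ => 0 end)) 1).
      apply (is_lim_seq_ext (fun _ => 1)); [|apply is_lim_seq_const].
      intros n; rewrite sum_n_Reals. induction n as [|n IH]; [reflexivity|].
      rewrite tech5, <- IH. ring. }
  pose proof (is_series_unique _ _ H1) as U1. rewrite (is_series_unique _ _ Hmul) in U1.
  set (E := Series (fun n => e n * s ^ n)) in *.
  set (G := Series (fun n => g n * s ^ n)) in *.
  assert (HG : 0 <= G <= B / (1 - s)).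
  { split.
    - replace 0 with (Series (fun n => 0 * s ^ n)).
      + apply Series_le; [|apply ex_series_Rabs, Hexg].
        intros n. rewrite Rmult_0_l. split; [lra | apply Hb].
      + rewrite Series_scal_l. ring.
    - unfold Rdiv. rewrite <- (is_series_unique _ _ HgeoB).
      apply Series_le; [exact Hb | eexists; apply HgeoB]. }
  assert (HE : 0 < E) by nra.
  apply Rle_div_l; [lra|].
  destruct HG as [HG0 HG]. apply Rle_div_r in HG; [|lra]. nra.
Qed.

Definition kneading_series (r : nat -> R) (a t : R) : R :=
  Series (fun n => t ^ n * kprod r a n).

Lemma kneading_series_abs_cv r a p t :
  0 <= p -> (forall k, Rabs (a - r k) <= p) -> 0 <= t -> t * p < 1 ->
  ex_series (fun n => Rabs (t ^ n * kprod r a n)).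
Proof.
  intros Hp Hr Ht Htp.
  apply (ex_series_Rabs_le _ (fun n => (t * p) ^ n)).
  - intros n. rewrite Rabs_mult, Rpow_mult_distr.
    rewrite (Rabs_right (t ^ n)) by (apply Rle_ge, pow_le; lra).
    apply Rmult_le_compat_l; [apply pow_le; lra | apply kprod_bound; auto].
  - exists (/ (1 - t * p)). apply is_series_geom. rewrite Rabs_right; nra.
Qed.

(** With [x_n = orbit a b n], the inverse branch turns [x_n - a] into
    [/ b * (a - r_n) * (x_(n+1) - b)], and the new term of the sum, times [b - a], replaces this [b]
    by [a]. *)
Lemma orbit_partial_sum a b n :
  inU a b ->
  (b - a) * sum_f_R0 (fun j => (/ b) ^ j * kprod (fun i => right_of a (orbit a b i)) a j) n
  = (/ b) ^ n * kprod (fun i => right_of a (orbit a b i)) a n * (orbit a b n - a).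
Proof.
  intros HU; induction n as [|n IH].
  - simpl. rewrite (orbit_0 _ _ HU). ring.
  - simpl sum_f_R0. rewrite Rmult_plus_distr_l, IH.
    rewrite <- (skew_tent_inverse_branch a b (orbit a b n) HU), <- orbit_S.
    simpl. ring.
Qed.

(** The remainder in [orbit_partial_sum] tends to [0]: the products decay geometrically and the
    orbit is bounded. *)
Lemma kneading_series_zero a b :
  inU a b ->
  kneading_series (fun i => right_of a (orbit a b i)) a (/ b) = 0.
Proof.
  intros HU. set (r := fun i => right_of a (orbit a b i)).
  destruct (contraction a b r HU) as (Hp & Hq & Hk).
  { intros k; apply right_of_01. }
  assert (Hb : 0 < / b) by (apply Rinv_0_lt_compat; destruct HU; lra).
  pose proof (kneading_series_abs_cv r a (Rmax a (1 - a)) (/ b) ltac:(lra) Hk ltac:(lra) Hq) as Habs.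
  pose proof (Series_correct _ (ex_series_Rabs _ Habs)) as Hs.
  pose proof (ex_series_lim_0 _ Habs) as H0.
  assert (Hlim : is_lim_seq (sum_n (fun n => (/ b) ^ n * kprod r a n)) 0).
  { apply is_lim_seq_abs_0.
    apply is_lim_seq_le_le with (u := fun _ => 0)
      (w := fun n => / (b - a) * Rabs ((/ b) ^ n * kprod r a n)).
    - intros n. split; [apply Rabs_pos|].
      rewrite sum_n_Reals.
      assert (Hba : 0 < b - a) by (destruct HU; lra).
      replace (sum_f_R0 _ n) with (/ (b - a) * ((/ b) ^ n * kprod r a n * (orbit a b n - a))).
      2:{ unfold r. rewrite <- orbit_partial_sum by exact HU. fold r. field; lra. }
      rewrite !Rabs_mult, (Rabs_right (/ (b - a))).
      2:{ left; apply Rinv_0_lt_compat; lra. }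
      apply Rmult_le_compat_l; [left; apply Rinv_0_lt_compat; lra|].
      rewrite <- (Rmult_1_r (_ * Rabs (kprod r a n))) at 2.
      apply Rmult_le_compat_l; [apply Rmult_le_pos; apply Rabs_pos|].
      pose proof (orbit_range a b n HU). apply Rabs_le. destruct HU; lra.
    - apply is_lim_seq_const.
    - replace (Finite 0) with (Rbar_mult (/ (b - a)) 0) by (simpl; f_equal; ring).
      apply is_lim_seq_scal_l, H0. }
  unfold kneading_series. apply is_series_unique. exact Hlim.
Qed.

Lemma kneading_series_lower_bound a b :
  inU a b -> exists K, 0 < K /\ forall t, 0 <= t < / b ->
  K * (/ b - t) <= kneading_series (fun i => right_of a (orbit a b i)) a t.
Proof.
  intros HU. destruct (crit_density_bounded a b HU) as (B & HB & Hg).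
  set (r := fun i => right_of a (orbit a b i)) in *.
  destruct (contraction a b r HU) as (Hp & Hq & Hk).
  { intros k; apply right_of_01. }
  assert (Hb0 : 0 < b <= 1 /\ 0 < a < b) by (destruct HU; lra).
  assert (Hb : 0 < / b) by (apply Rinv_0_lt_compat; lra).
  (* Chosen because [(b / B) * (/ b - t) = (1 - t*b) / B], the renewal bound at [s = t*b]. *)
  exists (b / B). split; [apply Rdiv_lt_0_compat; lra|].
  intros t Ht.
  assert (Htp : t * Rmax a (1 - a) < 1) by nra.
  pose proof (kneading_series_abs_cv r a (Rmax a (1 - a)) t ltac:(lra) Hk ltac:(lra) Htp) as Habs.
  assert (Hta : 0 <= t * a < 1).
  { split; [nra|]. pose proof (Rmax_l a (1 - a)). nra. }
  assert (Hts : 0 <= t * b < 1).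
  { split; [nra|]. replace 1 with (/ b * b) by (field; lra). nra. }
  set (c := fun n => t ^ n * kprod r a n) in *.
  (* In powers of [s = t*b], these are the coefficients of [(1 - t*a) * F(a,t)]. *)
  set (e := fun n => match n with O => 1 | S m => - (/ b) ^ S m * kprod r a m * r m end).
  assert (Hbt : forall n, (/ b) ^ n * (t * b) ^ n = t ^ n).
  { intros n. rewrite <- Rpow_mult_distr. f_equal. field; lra. }
  assert (Hce : forall n, e (S n) * (t * b) ^ S n = c (S n) - t * a * c n).
  { intros n. unfold e, c.
    transitivity (- ((/ b) ^ S n * (t * b) ^ S n) * kprod r a n * r n); [ring|].
    rewrite Hbt. simpl. ring. }
  assert (Hex : ex_series (fun n => Rabs (e n * (t * b) ^ n))).
  { apply ex_series_incr_1.
    apply (ex_series_Rabs_le (fun n => e (S n) * (t * b) ^ S n)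
             (fun n => Rabs (c (S n)) + t * a * Rabs (c n))).
    - intros n. rewrite Hce.
      eapply Rle_trans; [apply Rabs_triang|]. rewrite Rabs_Ropp, Rabs_mult, (Rabs_right (t * a)); lra.
    - apply (ex_series_plus (fun n => Rabs (c (S n))) (fun n => t * a * Rabs (c n))).
      + apply (ex_series_incr_1 (fun n => Rabs (c n))), Habs.
      + apply (ex_series_scal (t * a) (fun n => Rabs (c n))), Habs. }
  pose proof (renewal_lower_bound e (crit_density r a (/ b)) B (t * b)
     eq_refl eq_refl) as Hlow.
  assert (HD : (1 - t * b) / B <= Series (fun n => e n * (t * b) ^ n)).
  { apply Hlow; auto.
    - intros m. simpl crit_density.
      rewrite <- (Rmult_1_l (sum_f_R0 (fun j => e (S j) * _) m)), <- Ropp_mult_distr_l_reverse, scal_sum.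
      apply sum_eq. intros j Hj. rewrite coef_eq by exact Hj. unfold e. simpl. ring.
    - intros n. split; [apply crit_density_nonneg, HU | apply Hg]. }
  rewrite Series_incr_1 in HD by (apply ex_series_Rabs, Hex).
  rewrite (Series_ext _ (fun n => c (S n) - t * a * c n)) in HD by exact Hce.
  rewrite Series_minus in HD.
  2:{ apply (ex_series_incr_1 c), ex_series_Rabs, Habs. }
  2:{ apply (ex_series_scal (t * a) c), ex_series_Rabs, Habs. }
  rewrite Series_scal_l in HD.
  assert (HF : Series c = 1 + Series (fun n => c (S n))).
  { rewrite Series_incr_1 by (apply ex_series_Rabs, Habs). unfold c at 1. simpl. ring. }
  unfold kneading_series. fold c.
  replace (b / B * (/ b - t)) with ((1 - t * b) / B) by (field; lra).
  assert (0 < (1 - t * b) / B) by (apply Rdiv_lt_0_compat; lra).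
  simpl in HD.
  assert ((1 - t * b) / B <= (1 - t * a) * Series c) by lra.
  nra.
Qed.

(** * From the kneading sequence to the digits [r] *)

Lemma ext_kneading_C_iff a b n : ext_kneading a b n = Defs.C <-> tent_iter n a b a = a.
Proof.
  unfold ext_kneading. destruct (total_order_T (tent_iter n a b a) a) as [[h|h]|h];
  split; intros H; try discriminate; try reflexivity; try exact h; lra.
Qed.

Lemma tent_iter_return a b i m :
  tent_iter i a b a = a -> tent_iter (m + i) a b a = tent_iter m a b a.
Proof. intros H; induction m as [|m IH]; simpl; [exact H | now rewrite IH]. Qed.

Lemma ext_kneading_return a b i m :
  ext_kneading a b i = Defs.C -> ext_kneading a b (m + i) = ext_kneading a b m.
Proof.
  intros H%ext_kneading_C_iff. unfold ext_kneading. now rewrite (tent_iter_return a b i m H).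
Qed.

Lemma noC_upto_ext (m m' : nat -> sym) n :
  (forall i, (1 <= i <= n)%nat -> m i = m' i) -> noC_upto m n = noC_upto m' n.
Proof.
  intros H; induction n as [|n IH]; simpl; auto.
  rewrite IH by (intros; apply H; lia). now rewrite H by lia.
Qed.

Lemma noC_upto_false (m : nat -> sym) n :
  noC_upto m n = false -> exists i, (1 <= i <= n)%nat /\ m i = Defs.C.
Proof.
  induction n as [|n IH]; simpl; [discriminate|].
  destruct (noC_upto m n); simpl; intros H.
  - exists (S n). split; [lia|]. destruct (m (S n)); simpl in H; congruence.
  - destruct IH as (i & Hi & E); auto. exists i; split; [lia | exact E].
Qed.

(* After the first [C] the critical orbit is periodic, so the finite string
   determines the rest of the extended sequence. *)
Lemma kneading_determines_ext a b a' b' :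
  kneading a b = kneading a' b' ->
  forall n, (1 <= n)%nat -> ext_kneading a b n = ext_kneading a' b' n.
Proof.
  intros HK n; induction n as [n IH] using (well_founded_induction Wf_nat.lt_wf).
  destruct n as [|n]; [lia|]. intros _.
  assert (Hpre : forall i, (1 <= i <= n)%nat -> ext_kneading a b i = ext_kneading a' b' i).
  { intros i Hi; apply IH; lia. }
  pose proof (noC_upto_ext _ _ n Hpre) as HE.
  pose proof (f_equal (fun k => k (S n)) HK) as HS. simpl in HS. rewrite <- HE in HS.
  destruct (noC_upto (ext_kneading a b) n) eqn:E; [congruence|].
  destruct (noC_upto_false _ _ E) as (i & Hi & HC).
  pose proof HC as HC'. rewrite Hpre in HC' by exact Hi.
  replace (S n) with ((S n - i) + i)%nat by lia.
  rewrite !ext_kneading_return by assumption. apply IH; lia.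
Qed.

(** Hence the digits are constant along an isentrope, and all its points satisfy one equation. *)
Lemma kneading_determines_side a b a' b' :
  kneading a b = kneading a' b' ->
  forall n, right_of a (orbit a b n) = right_of a' (orbit a' b' n).
Proof.
  intros HK n. pose proof (kneading_determines_ext _ _ _ _ HK (S n) ltac:(lia)) as H.
  revert H. unfold ext_kneading, right_of, orbit.
  destruct (total_order_T (tent_iter (S n) a b a) a) as [[h|h]|h];
  destruct (total_order_T (tent_iter (S n) a' b' a') a') as [[h'|h']|h'];
  intros H; try discriminate;
  destruct (Rle_dec a (tent_iter (S n) a b a));
  destruct (Rle_dec a' (tent_iter (S n) a' b' a')); lra.
Qed.

(** * Divided differences and dominated series *)

(* Divided difference of the polynomial [kprod r _ n] at [x] and [x']. *)
Fixpoint kprod_dd (r : nat -> R) (x x' : R) (n : nat) : R :=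
  match n with
  | O => 0
  | S k => kprod_dd r x x' k * (x' - r k) + kprod r x k
  end.

Lemma kprod_sub r x x' n :
  kprod r x' n - kprod r x n = (x' - x) * kprod_dd r x x' n.
Proof.
  induction n as [|n IH]; simpl; [ring|].
  transitivity ((kprod r x' n - kprod r x n) * (x' - r n) + kprod r x n * (x' - x)); [ring|].
  rewrite IH. ring.
Qed.

Lemma kprod_pow t n : kprod (fun _ => 0) t n = t ^ n.
Proof. induction n as [|n IH]; simpl; [reflexivity | rewrite IH; ring]. Qed.

(** The divided difference is a sum of [n] products of [n-1] factors; [/ p * p^n] stands for
    [p^(n-1)] and avoids a predecessor. *)
Lemma kprod_dd_bound r x x' p n :
  0 < p -> (forall k, Rabs (x - r k) <= p) -> (forall k, Rabs (x' - r k) <= p) ->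
  Rabs (kprod_dd r x x' n) <= / p * (INR n * p ^ n).
Proof.
  intros Hp Hx Hx'.
  assert (H : p * Rabs (kprod_dd r x x' n) <= INR n * p ^ n).
  { induction n as [|n IH].
    - simpl. rewrite Rabs_R0. lra.
    - rewrite S_INR. simpl kprod_dd. simpl pow.
      assert (Rabs (kprod_dd r x x' n * (x' - r n)) <= Rabs (kprod_dd r x x' n) * p).
      { rewrite Rabs_mult. apply Rmult_le_compat_l; auto using Rabs_pos. }
      pose proof (kprod_bound r x p n ltac:(lra) Hx).
      pose proof (Rabs_triang (kprod_dd r x x' n * (x' - r n)) (kprod r x n)).
      pose proof (pow_lt p n Hp). nra. }
  apply Rmult_le_reg_l with p; [lra|]. rewrite <- Rmult_assoc, Rinv_r by lra. lra.
Qed.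

(** With [s = sqrt q], Bernoulli's inequality gives [n * (1/s - 1) <= s^(-n)], so [n * q^n] is at
    most a constant times [s^n]. *)
Lemma ex_series_arith_geom q : 0 <= q < 1 -> ex_series (fun n => INR n * q ^ n).
Proof.
  intros Hq. destruct (Req_dec q 0) as [->|Hq0].
  { exists 0. change (is_lim_seq (sum_n (fun n => INR n * 0 ^ n)) 0).
    apply (is_lim_seq_ext (fun _ => 0)); [|apply is_lim_seq_const].
    intros n; rewrite sum_n_Reals. induction n as [|n IH]; [simpl; ring|].
    rewrite tech5, <- IH. simpl. ring. }
  set (s := sqrt q).
  assert (Hs2 : s * s = q) by (apply sqrt_sqrt; lra).
  assert (Hs : 0 < s) by (apply sqrt_lt_R0; lra).
  assert (Hs1 : s < 1) by nra.
  assert (Hi : 0 < / s - 1).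
  { apply Rmult_lt_reg_l with s; [lra|]. rewrite Rmult_minus_distr_l, Rinv_r; lra. }
  apply ex_series_Rabs.
  apply (ex_series_Rabs_le _ (fun n => / (/ s - 1) * s ^ n)).
  - intros n. rewrite Rabs_right.
    2:{ apply Rle_ge, Rmult_le_pos; [apply pos_INR | apply pow_le; lra]. }
    rewrite <- Hs2, Rpow_mult_distr, <- Rmult_assoc.
    apply Rmult_le_compat_r; [apply pow_le; lra|].
    pose proof (poly n (/ s - 1) Hi) as Hb.
    replace (1 + (/ s - 1)) with (/ s) in Hb by ring. rewrite pow_inv in Hb.
    pose proof (pow_lt s n Hs).
    apply Rmult_le_reg_l with (/ s - 1); [lra|]. rewrite Rinv_r by lra.
    apply Rmult_le_reg_r with (/ s ^ n); [apply Rinv_0_lt_compat; lra|].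
    rewrite <- Rmult_assoc, Rmult_assoc, Rinv_r by lra. lra.
  - apply (ex_series_scal (/ (/ s - 1)) (fun n => s ^ n)).
    exists (/ (1 - s)). apply is_series_geom. rewrite Rabs_right; lra.
Qed.

(** Weierstrass M-test: the tails stay below [eps/3] uniformly near [x], and the finite head is
    continuous. *)
Lemma Series_continuous (f : nat -> R -> R) (M : nat -> R) (x : R) :
  locally x (fun y => forall n, Rabs (f n y) <= M n) ->
  ex_series M -> (forall n, continuous (f n) x) ->
  continuous (fun y => Series (fun n => f n y)) x.
Proof.
  intros Hb HM Hc. apply filterlim_locally. intros eps.
  assert (He : 0 < eps / 3) by (destruct eps; simpl; lra).
  pose proof (Series_correct _ HM) as Hs.
  change (is_lim_seq (sum_n M) (Series M)) in Hs.
  apply is_lim_seq_spec in Hs. destruct (Hs (mkposreal _ He)) as (N & HN).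
  specialize (HN N ltac:(lia)). simpl in HN. rewrite sum_n_Reals in HN.
  rewrite (Series_incr_n M (S N) ltac:(lia) HM) in HN. simpl pred in HN.
  assert (HT : Series (fun k => M (S N + k)%nat) < eps / 3).
  { apply Rabs_lt_between in HN. lra. }
  assert (Htail : forall y, (forall n, Rabs (f n y) <= M n) ->
     Rabs (Series (fun n => f n y) - sum_f_R0 (fun n => f n y) N) < eps / 3).
  { intros y Hy.
    pose proof (ex_series_Rabs_le _ _ Hy HM) as Hay.
    rewrite (Series_incr_n (fun n => f n y) (S N) ltac:(lia) (ex_series_Rabs _ Hay)).
    simpl pred.
    replace (_ + _ - _) with (Series (fun k => f (S N + k)%nat y)) by ring.
    eapply Rle_lt_trans; [|exact HT].
    assert (HMt : ex_series (fun k => M (S N + k)%nat)) by (apply ex_series_incr_n, HM).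
    eapply Rle_trans; [apply Series_Rabs|].
    - apply (ex_series_Rabs_le _ (fun k => M (S N + k)%nat)); auto.
    - apply Series_le; auto. intros n; split; [apply Rabs_pos | apply Hy]. }
  assert (Hfin : continuous (fun y => sum_f_R0 (fun n => f n y) N) x).
  { clear -Hc. induction N as [|N IH]; simpl; [apply Hc|].
    apply (continuous_plus (fun y => sum_f_R0 (fun n => f n y) N) (f (S N))); auto. }
  pose proof (proj1 (filterlim_locally _ _) Hfin (mkposreal _ He)) as Hl.
  pose proof (locally_singleton _ _ Hb) as Hx.
  generalize (filter_and _ _ Hb Hl). apply filter_imp. intros y [Hy Hyl].
  change (Rabs (sum_f_R0 (fun n => f n y) N - sum_f_R0 (fun n => f n x) N) < eps / 3) in Hyl.
  change (Rabs (Series (fun n => f n y) - Series (fun n => f n x)) < eps).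
  pose proof (Htail y Hy) as H1. pose proof (Htail x Hx) as H2.
  apply Rabs_lt_between in H1. apply Rabs_lt_between in H2. apply Rabs_lt_between in Hyl.
  apply Rabs_lt_between. lra.
Qed.

(** Powers of [t] are products with all digits [0], so this symmetric form lets the same lemmas
    treat the variables [a] and [t]. *)
Definition kseries (r1 r2 : nat -> R) (x y : R) : R :=
  Series (fun n => kprod r1 x n * kprod r2 y n).

(** Difference quotient of [kseries] in its first variable, and its termwise partial derivative when
    [x = x']. *)
Definition kseries_dd (r1 r2 : nat -> R) (x x' y : R) : R :=
  Series (fun n => kprod_dd r1 x x' n * kprod r2 y n).

Lemma kseries_comm r1 r2 x y : kseries r1 r2 x y = kseries r2 r1 y x.
Proof. apply Series_ext; intros; ring. Qed.

Lemma kneading_series_kseries r a t :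
  kneading_series r a t = kseries r (fun _ => 0) a t.
Proof. apply Series_ext; intros n. rewrite kprod_pow. ring. Qed.

Definition near_digits (r : nat -> R) (p x : R) : Prop := forall k, Rabs (x - r k) <= p.

Lemma kseries_term_bound r1 r2 x y p q n :
  0 <= p -> 0 <= q -> near_digits r1 p x -> near_digits r2 q y ->
  Rabs (kprod r1 x n * kprod r2 y n) <= (p * q) ^ n.
Proof.
  intros. rewrite Rabs_mult, Rpow_mult_distr.
  apply Rmult_le_compat; auto using Rabs_pos, kprod_bound.
Qed.

Lemma kseries_dd_term_bound r1 r2 x x' y p q n :
  0 < p -> 0 <= q -> near_digits r1 p x -> near_digits r1 p x' -> near_digits r2 q y ->
  Rabs (kprod_dd r1 x x' n * kprod r2 y n) <= / p * (INR n * (p * q) ^ n).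
Proof.
  intros. rewrite Rabs_mult, Rpow_mult_distr.
  replace (/ p * (INR n * (p ^ n * q ^ n))) with (/ p * (INR n * p ^ n) * q ^ n) by ring.
  apply Rmult_le_compat; auto using Rabs_pos, kprod_bound, kprod_dd_bound.
Qed.

Lemma ex_series_dd_majorant p q :
  0 < p -> 0 <= q -> p * q < 1 -> ex_series (fun n => / p * (INR n * (p * q) ^ n)).
Proof.
  intros. apply (ex_series_scal (/ p) (fun n => INR n * (p * q) ^ n)).
  apply ex_series_arith_geom. nra.
Qed.

Lemma kseries_sub r1 r2 x x' y p q :
  0 < p -> 0 <= q -> p * q < 1 ->
  near_digits r1 p x -> near_digits r1 p x' -> near_digits r2 q y ->
  kseries r1 r2 x' y - kseries r1 r2 x y = (x' - x) * kseries_dd r1 r2 x x' y.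
Proof.
  intros Hp Hq Hpq Hx Hx' Hy. unfold kseries, kseries_dd.
  assert (Hg : ex_series (fun n => (p * q) ^ n)).
  { exists (/ (1 - p * q)). apply is_series_geom. rewrite Rabs_right; nra. }
  rewrite <- Series_minus.
  - rewrite <- Series_scal_l. apply Series_ext. intros n.
    rewrite <- Rmult_assoc, <- kprod_sub. ring.
  - apply ex_series_Rabs, (ex_series_Rabs_le _ (fun n => (p * q) ^ n)); auto.
    intros; apply kseries_term_bound; auto; lra.
  - apply ex_series_Rabs, (ex_series_Rabs_le _ (fun n => (p * q) ^ n)); auto.
    intros; apply kseries_term_bound; auto; lra.
Qed.

Lemma kseries_dd_bound r1 r2 x x' y p q :
  0 < p -> 0 <= q -> p * q < 1 ->
  near_digits r1 p x -> near_digits r1 p x' -> near_digits r2 q y ->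
  Rabs (kseries_dd r1 r2 x x' y) <= Series (fun n => / p * (INR n * (p * q) ^ n)).
Proof.
  intros Hp Hq Hpq Hx Hx' Hy. unfold kseries_dd.
  pose proof (ex_series_dd_majorant p q Hp Hq Hpq) as HM.
  eapply Rle_trans; [apply Series_Rabs|].
  - apply (ex_series_Rabs_le _ (fun n => / p * (INR n * (p * q) ^ n))); auto.
    intros; apply kseries_dd_term_bound; auto.
  - apply Series_le; auto. intros; split; [apply Rabs_pos | apply kseries_dd_term_bound; auto].
Qed.

Lemma kprod_continuous r (f : R -> R) x n :
  continuous f x -> continuous (fun y => kprod r (f y) n) x.
Proof.
  intros Hf; induction n as [|n IH]; simpl; [apply continuous_const|].
  apply (continuous_mult (fun y => kprod r (f y) n) (fun y => f y - r n)); auto.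
  apply (continuous_minus f (fun _ => r n)); auto. apply continuous_const.
Qed.

Lemma kprod_dd_continuous r (f g : R -> R) x n :
  continuous f x -> continuous g x -> continuous (fun y => kprod_dd r (f y) (g y) n) x.
Proof.
  intros Hf Hg; induction n as [|n IH]; simpl; [apply continuous_const|].
  apply (continuous_plus (fun y => kprod_dd r (f y) (g y) n * (g y - r n))
           (fun y => kprod r (f y) n)); [|apply kprod_continuous, Hf].
  apply (continuous_mult (fun y => kprod_dd r (f y) (g y) n) (fun y => g y - r n)); auto.
  apply (continuous_minus g (fun _ => r n)); auto. apply continuous_const.
Qed.

Lemma kseries_dd_continuous r1 r2 (f g h : R -> R) x p q :
  0 < p -> 0 <= q -> p * q < 1 ->
  locally x (fun y => near_digits r1 p (f y) /\ near_digits r1 p (g y)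
                      /\ near_digits r2 q (h y)) ->
  continuous f x -> continuous g x -> continuous h x ->
  continuous (fun y => kseries_dd r1 r2 (f y) (g y) (h y)) x.
Proof.
  intros Hp Hq Hpq Hl Hf Hg Hh. unfold kseries_dd.
  apply (Series_continuous (fun n y => kprod_dd r1 (f y) (g y) n * kprod r2 (h y) n)
           (fun n => / p * (INR n * (p * q) ^ n))).
  - revert Hl; apply filter_imp. intros y (H1 & H2 & H3) n.
    apply kseries_dd_term_bound; auto.
  - apply ex_series_dd_majorant; auto.
  - intros n. apply (continuous_mult (fun y => kprod_dd r1 (f y) (g y) n) (fun y => kprod r2 (h y) n)).
    + apply kprod_dd_continuous; auto.
    + apply kprod_continuous; auto.
Qed.

Lemma near_digits_max (r : nat -> R) p x :
  (forall k, r k = 0 \/ r k = 1) -> 0 <= x <= 1 -> Rmax x (1 - x) <= p -> near_digits r p x.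
Proof.
  intros Hr Hx Hp k. pose proof (Rmax_l x (1 - x)). pose proof (Rmax_r x (1 - x)).
  apply Rabs_le. destruct (Hr k) as [-> | ->]; lra.
Qed.

Lemma near_digits_0 q y : 0 <= y <= q -> near_digits (fun _ => 0) q y.
Proof. intros H k. rewrite Rminus_0_r, Rabs_right; lra. Qed.

(** The slack lets one geometric majorant serve a whole neighbourhood. With [e = 1 - x*y] the choice
    works because [(1-e) * (1 + e/4)^2 < 1]. *)
Lemma enlarge_factors x y : 0 < x -> 0 < y -> x * y < 1 ->
  exists x' y', x < x' /\ y < y' /\ x' * y' < 1.
Proof.
  intros Hx Hy Hxy. exists (x * (1 + (1 - x * y) / 4)), (y * (1 + (1 - x * y) / 4)).
  assert (0 < x * y) by nra. set (d := x * y) in *.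
  split; [nra|]. split; [nra|].
  replace (x * (1 + (1 - d) / 4) * (y * (1 + (1 - d) / 4)))
    with (d * ((1 + (1 - d) / 4) * (1 + (1 - d) / 4))) by (unfold d; ring).
  set (e := 1 - d). replace d with (1 - e) by (unfold e; ring).
  assert (0 < e < 1) by (unfold e; lra). nra.
Qed.

(** * Regularity of the curve of smallest zeros *)

(** For [t < t0] the difference quotient of [F(a,.)] between [t0] and [t] is at most [-K]; by
    continuity so is the derivative at [t0]. *)
Lemma kseries_dd_zero_neg r a t0 K T p :
  0 < K -> 0 < t0 < T -> 0 < p -> T * p < 1 -> near_digits r p a ->
  kneading_series r a t0 = 0 ->
  (forall t, 0 <= t < t0 -> K * (t0 - t) <= kneading_series r a t) ->
  continuous (fun t => kseries_dd (fun _ => 0) r t0 t a) t0 /\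
  kseries_dd (fun _ => 0) r t0 t0 a < 0.
Proof.
  intros HK Ht0 Hp HTp Ha Hz Hlow.
  assert (Hc : continuous (fun t => kseries_dd (fun _ => 0) r t0 t a) t0).
  { apply (kseries_dd_continuous (fun _ => 0) r (fun _ => t0) (fun t => t) (fun _ => a) t0 T p);
      try lra.
    - apply (locally_interval _ _ 0 T); simpl; try lra.
      intros t H0 H1. split; [|split]; auto; apply near_digits_0; simpl in *; lra.
    - apply continuous_const.
    - apply continuous_id.
    - apply continuous_const. }
  split; [exact Hc|].
  destruct (Rlt_dec (kseries_dd (fun _ => 0) r t0 t0 a) 0) as [|Hn]; auto. exfalso.
  pose proof (proj1 (filterlim_locally _ _) Hc (mkposreal _ HK)) as [eps Heps].
  pose proof (cond_pos eps) as Hep.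
  set (t := t0 - Rmin (eps / 2) t0).
  assert (Hm : 0 < Rmin (eps / 2) t0) by (apply Rmin_glb_lt; lra).
  pose proof (Rmin_l (eps / 2) t0). pose proof (Rmin_r (eps / 2) t0).
  assert (Hball : Rabs (t - t0) < eps) by (unfold t; apply Rabs_lt_between; lra).
  specialize (Heps t Hball).
  change (Rabs (kseries_dd (fun _ => 0) r t0 t a - kseries_dd (fun _ => 0) r t0 t0 a) < K) in Heps.
  apply Rabs_lt_between in Heps.
  specialize (Hlow t ltac:(unfold t; lra)).
  assert (E : kneading_series r a t - kneading_series r a t0
              = (t - t0) * kseries_dd (fun _ => 0) r t0 t a).
  { rewrite !kneading_series_kseries, !(kseries_comm r).
    apply (kseries_sub _ _ _ _ _ T p); auto; try lra; apply near_digits_0; unfold t; lra. }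
  rewrite Hz in E.
  assert (0 < t0 - t) by (unfold t; lra). nra.
Qed.

(** Carathéodory's form of differentiability. *)
Lemma derivable_pt_lim_of_slope (f q : R -> R) x :
  locally x (fun y => f y - f x = (y - x) * q y) -> continuous q x ->
  derivable_pt_lim f x (q x).
Proof.
  intros [d1 Hd1] Hq eps Heps.
  destruct (proj1 (filterlim_locally _ _) Hq (mkposreal _ Heps)) as [d2 Hd2].
  assert (Hm : 0 < Rmin d1 d2) by (apply Rmin_glb_lt; apply cond_pos).
  exists (mkposreal _ Hm). intros h Hh Hhd. simpl in Hhd.
  pose proof (Rmin_l d1 d2). pose proof (Rmin_r d1 d2).
  assert (Eh : x + h - x = h) by ring.
  rewrite Hd1 by (change (Rabs (x + h - x) < d1); rewrite Eh; lra).
  rewrite Eh. replace (h * q (x + h) / h) with (q (x + h)) by (field; auto).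
  apply Hd2. change (Rabs (x + h - x) < d2); rewrite Eh; lra.
Qed.

(** The quotient [- F_a / F_t] of implicit differentiation, with divided differences along the path
    from [(a,t)] through [(a,t')] to [(a',t')]. *)
Definition zero_slope (r : nat -> R) (a a' t t' : R) : R :=
  - kseries_dd r (fun _ => 0) a a' t' / kseries_dd (fun _ => 0) r t t' a.

Lemma zero_curve_C1 (r : nat -> R) (a1 a2 : R) (tau : R -> R) :
  (forall k, r k = 0 \/ r k = 1) ->
  (forall a, a1 < a < a2 ->
     0 < a < 1 /\ 0 < tau a /\ tau a * Rmax a (1 - a) < 1 /\
     kneading_series r a (tau a) = 0 /\
     exists K, 0 < K /\ forall t, 0 <= t < tau a -> K * (tau a - t) <= kneading_series r a t) ->
  forall a, a1 < a < a2 ->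
    derivable_pt_lim tau a (zero_slope r a a (tau a) (tau a)) /\
    continuous (fun x => zero_slope r x x (tau x) (tau x)) a.
Proof.
  intros Hr Hz a Ha.
  destruct (Hz a Ha) as (Ha01 & Ht0 & Htp & Hzero & K & HK & Hlow).
  assert (Hp0 : 0 < Rmax a (1 - a)) by (pose proof (Rmax_l a (1 - a)); lra).
  destruct (enlarge_factors _ _ Ht0 Hp0 Htp) as (T & p & HT & Hp & HTp).
  assert (Hpos : 0 < p /\ 0 < T) by lra. destruct Hpos as [Hp' HT'].
  assert (HpT : p * T < 1) by lra.
  assert (Hnear : locally a (fun x => a1 < x < a2 /\ near_digits r p x)).
  { assert (He : 0 < Rmin (Rmin (a - a1) (a2 - a)) (p - Rmax a (1 - a))).
    { repeat apply Rmin_glb_lt; lra. }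
    exists (mkposreal _ He). intros x Hx. change (Rabs (x - a) < Rmin (Rmin (a - a1) (a2 - a)) (p - Rmax a (1 - a))) in Hx.
    pose proof (Rmin_l (Rmin (a - a1) (a2 - a)) (p - Rmax a (1 - a))).
    pose proof (Rmin_r (Rmin (a - a1) (a2 - a)) (p - Rmax a (1 - a))).
    pose proof (Rmin_l (a - a1) (a2 - a)). pose proof (Rmin_r (a - a1) (a2 - a)).
    apply Rabs_lt_between in Hx. pose proof (Rmax_l a (1 - a)). pose proof (Rmax_r a (1 - a)).
    assert (Hx' : a1 < x < a2) by lra. split; auto.
    apply near_digits_max; auto.
    - destruct (Hz x Hx'); lra.
    - apply Rmax_lub; lra. }
  assert (Hna : near_digits r p a) by (apply near_digits_max; auto; lra).
  destruct (kseries_dd_zero_neg r a (tau a) K T p) as [Hphi Hneg]; auto; try lra.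
  set (M := Series (fun n => / p * (INR n * (p * T) ^ n))).
  assert (Hlip : forall x t, near_digits r p x -> 0 <= t <= T ->
            Rabs (kneading_series r x t - kneading_series r a t) <= Rabs (x - a) * M).
  { intros x t Hx Ht. rewrite !kneading_series_kseries.
    rewrite (kseries_sub _ _ _ _ _ p T); auto using near_digits_0; try lra.
    rewrite Rabs_mult. apply Rmult_le_compat_l; [apply Rabs_pos|].
    apply kseries_dd_bound; auto using near_digits_0; lra. }
  assert (HM : 0 <= M).
  { eapply Rle_trans; [apply Rabs_pos|].
    apply (kseries_dd_bound r (fun _ => 0) a a (tau a) p T); auto; try lra.
    apply near_digits_0; lra. }
  assert (Hcont : continuous tau a).
  { apply filterlim_locally. intros eps. pose proof (cond_pos eps) as Hep.
    assert (Hphi0 : 0 < - kseries_dd (fun _ => 0) r (tau a) (tau a) a) by lra.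
    destruct (proj1 (filterlim_locally _ _) Hphi (mkposreal _ Hphi0)) as [d Hd].
    pose proof (cond_pos d) as Hdp.
    set (s := Rmin (Rmin (eps / 2) (d / 2)) (T - tau a)).
    assert (Hs : 0 < s) by (repeat apply Rmin_glb_lt; lra).
    assert (Hs' : s <= eps / 2 /\ s <= d / 2 /\ s <= T - tau a).
    { pose proof (Rmin_l (Rmin (eps / 2) (d / 2)) (T - tau a)).
      pose proof (Rmin_r (Rmin (eps / 2) (d / 2)) (T - tau a)).
      pose proof (Rmin_l (eps / 2) (d / 2)). pose proof (Rmin_r (eps / 2) (d / 2)).
      unfold s; lra. }
    (* Just beyond its simple zero [F(a,.)] is negative; [t1] will be an upper barrier for nearby
       [tau x]. *)
    set (t1 := tau a + s).
    assert (HF1 : kneading_series r a t1 < 0).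
    { assert (Hb : ball (tau a) d t1).
      { change (Rabs (t1 - tau a) < d). unfold t1. apply Rabs_lt_between; lra. }
      specialize (Hd t1 Hb).
      change (Rabs (kseries_dd (fun _ => 0) r (tau a) t1 a - kseries_dd (fun _ => 0) r (tau a) (tau a) a)
              < - kseries_dd (fun _ => 0) r (tau a) (tau a) a) in Hd.
      apply Rabs_lt_between in Hd.
      assert (E : kneading_series r a t1 - kneading_series r a (tau a)
              = (t1 - tau a) * kseries_dd (fun _ => 0) r (tau a) t1 a).
      { rewrite !kneading_series_kseries, !(kseries_comm r).
        apply (kseries_sub _ _ _ _ _ T p); auto; try lra; apply near_digits_0; unfold t1; lra. }
      rewrite Hzero in E. assert (t1 - tau a = s) by (unfold t1; ring). nra. }
    (* The first bound keeps [F(x,t1)] negative, the second serves the lower estimate; dividing by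
       [M + 1] below allows [M = 0]. *)
    set (e := Rmin (- kneading_series r a t1) (K * eps)).
    assert (He : 0 < e).
    { apply Rmin_glb_lt; [lra | apply Rmult_lt_0_compat; lra]. }
    pose proof (Rmin_l (- kneading_series r a t1) (K * eps)) as He1.
    pose proof (Rmin_r (- kneading_series r a t1) (K * eps)) as He2. fold e in He1, He2.
    assert (Heta : 0 < e / (M + 1)) by (apply Rdiv_lt_0_compat; lra).
    assert (Hclose : locally a (fun x => Rabs (x - a) < e / (M + 1))).
    { exists (mkposreal _ Heta). intros x Hx; exact Hx. }
    generalize (filter_and _ _ Hnear Hclose). apply filter_imp.
    intros x [[Hx12 Hxn] Hxa].
    assert (HxM : Rabs (x - a) * M < e).
    { apply Rlt_div_r in Hxa; [|lra]. pose proof (Rabs_pos (x - a)). nra. }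
    destruct (Hz x Hx12) as (_ & Htx & _ & Hzx & K' & HK' & Hlowx).
    change (Rabs (tau x - tau a) < eps). apply Rabs_lt_between. split.
    (* If [tau x < tau a], then [K * (tau a - tau x) <= F(a, tau x)], which is below [K * eps]
       because [F(x, tau x) = 0]. *)
    - destruct (Rlt_dec (tau x) (tau a)) as [h|h]; [|lra].
      pose proof (Hlip x (tau x) Hxn ltac:(lra)) as Hl. rewrite Hzx in Hl.
      specialize (Hlow (tau x) ltac:(lra)).
      rewrite Rminus_0_l, Rabs_Ropp in Hl.
      pose proof (Rle_abs (kneading_series r a (tau x))).
      assert (K * (tau a - tau x) < K * eps) by lra.
      apply Rmult_lt_reg_l in H0; lra.
    (* If [tau x > t1], minimality of [tau x] would make [F(x,t1)] positive. *)
    - destruct (Rle_dec (tau x) t1) as [h|h]; [unfold t1 in h; lra|].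
      specialize (Hlowx t1 ltac:(unfold t1 in *; lra)).
      pose proof (Hlip x t1 Hxn ltac:(unfold t1; lra)) as Hl.
      pose proof (Rle_abs (kneading_series r x t1 - kneading_series r a t1)).
      assert (0 < K' * (tau x - t1)) by (apply Rmult_lt_0_compat; lra). lra. }
  assert (Htau : locally a (fun x => near_digits (fun _ => 0) T (tau x))).
  { assert (He : 0 < T - tau a) by lra.
    pose proof (proj1 (filterlim_locally _ _) Hcont (mkposreal _ He)) as Hl.
    generalize (filter_and _ _ Hnear Hl). apply filter_imp. intros x [[Hx _] Hxl].
    change (Rabs (tau x - tau a) < T - tau a) in Hxl. apply Rabs_lt_between in Hxl.
    destruct (Hz x Hx) as (_ & ? & _). apply near_digits_0; lra. }
  pose proof (locally_singleton _ _ Htau) as Hta.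
  split.
  - apply (derivable_pt_lim_of_slope tau (fun x => zero_slope r a x (tau a) (tau x))).
    + assert (Hne : locally a (fun x => kseries_dd (fun _ => 0) r (tau a) (tau x) a < 0)).
      { pose proof (continuous_comp tau (fun t => kseries_dd (fun _ => 0) r (tau a) t a) a Hcont Hphi) as Hc.
        assert (Hphi0 : 0 < - kseries_dd (fun _ => 0) r (tau a) (tau a) a) by lra.
        generalize (proj1 (filterlim_locally _ _) Hc (mkposreal _ Hphi0)). apply filter_imp.
        intros x Hx.
        change (Rabs (kseries_dd (fun _ => 0) r (tau a) (tau x) a - kseries_dd (fun _ => 0) r (tau a) (tau a) a)
              < - kseries_dd (fun _ => 0) r (tau a) (tau a) a) in Hx.
        apply Rabs_lt_between in Hx. lra. }
      generalize (filter_and _ _ Hne (filter_and _ _ Hnear Htau)). apply filter_imp.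
      intros x (Hxne & [Hx Hxn] & Hxt).
      destruct (Hz x Hx) as (_ & _ & _ & Hzx & _).
      (* Both differences are taken from the corner value [F(a, tau x)]; since [F] vanishes at both
         ends of the path, they yield the slope of [tau]. *)
      pose proof (kseries_sub r (fun _ => 0) a x (tau x) p T) as E1.
      rewrite <- !kneading_series_kseries, Hzx in E1.
      pose proof (kseries_sub (fun _ => 0) r (tau a) (tau x) a T p) as E2.
      rewrite <- !(kseries_comm r), <- !kneading_series_kseries, Hzero in E2.
      specialize (E1 ltac:(lra) ltac:(lra) ltac:(lra) Hna Hxn Hxt).
      specialize (E2 ltac:(lra) ltac:(lra) ltac:(lra) Hta Hxt Hna).
      unfold zero_slope.
      apply Rmult_eq_reg_r with (kseries_dd (fun _ => 0) r (tau a) (tau x) a); [|lra].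
      rewrite <- E2. transitivity (- ((x - a) * kseries_dd r (fun _ => 0) a x (tau x))).
      * rewrite <- E1. ring.
      * field. lra.
    + unfold zero_slope.
      apply (continuous_mult (fun x => - kseries_dd r (fun _ => 0) a x (tau x))
               (fun x => / kseries_dd (fun _ => 0) r (tau a) (tau x) a)).
      * apply (continuous_opp (fun x => kseries_dd r (fun _ => 0) a x (tau x))).
        apply (kseries_dd_continuous r (fun _ => 0) (fun _ => a) (fun x => x) tau a p T); auto; try lra.
        -- generalize (filter_and _ _ Hnear Htau). apply filter_imp. tauto.
        -- apply continuous_const.
        -- apply continuous_id.
      * apply continuous_Rinv_comp; [|lra].
        apply (continuous_comp tau (fun t => kseries_dd (fun _ => 0) r (tau a) t a)); auto.
  - unfold zero_slope.
    apply (continuous_mult (fun x => - kseries_dd r (fun _ => 0) x x (tau x))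
             (fun x => / kseries_dd (fun _ => 0) r (tau x) (tau x) x)).
    + apply (continuous_opp (fun x => kseries_dd r (fun _ => 0) x x (tau x))).
      apply (kseries_dd_continuous r (fun _ => 0) (fun x => x) (fun x => x) tau a p T);
        auto using continuous_id; try lra.
      generalize (filter_and _ _ Hnear Htau). apply filter_imp. tauto.
    + apply continuous_Rinv_comp; [|lra].
      apply (kseries_dd_continuous (fun _ => 0) r tau tau (fun x => x) a T p);
        auto using continuous_id; try lra.
      generalize (filter_and _ _ Hnear Htau). apply filter_imp. tauto.
Qed.

(* M = K(a0,b0) with (a0,b0) in U; (a1,a2,Psi) are the data of the
   Misiurewicz–Visinescu result for M, given via their characterizing
   property. *)
Theorem theorem1p1 (a0 b0 : R) (H0 : inU a0 b0)
  (a1 a2 : R) (Psi : R -> R) (Ha : a1 < a2)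
  (HU : forall a, a1 < a < a2 -> inU a (Psi a))
  (Hiso : forall a b, inU a b ->
     (kneading a b = kneading a0 b0 <-> (a1 < a < a2 /\ b = Psi a))) :
  exists dPsi : R -> R,
    (forall a, a1 < a < a2 -> derivable_pt_lim Psi a (dPsi a)) /\
    (forall a, a1 < a < a2 -> continuity_pt dPsi a).
Proof.
  set (r := fun n => right_of a0 (orbit a0 b0 n)).
  assert (Hr : forall k, r k = 0 \/ r k = 1) by (intros; apply right_of_01).
  assert (Hcurve : forall a, a1 < a < a2 ->
     0 < a < 1 /\ 0 < / Psi a /\ / Psi a * Rmax a (1 - a) < 1 /\
     kneading_series r a (/ Psi a) = 0 /\
     exists K, 0 < K /\ forall t, 0 <= t < / Psi a ->
       K * (/ Psi a - t) <= kneading_series r a t).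
  { intros a Haa. pose proof (HU a Haa) as Hu.
    assert (Hk : kneading a (Psi a) = kneading a0 b0) by (apply Hiso; auto).
    pose proof (kneading_determines_side _ _ _ _ Hk) as Hside.
    assert (Hser : forall t, kneading_series (fun i => right_of a (orbit a (Psi a) i)) a t
                   = kneading_series r a t).
    { intros t. apply Series_ext. intros n. f_equal.
      induction n as [|n IH]; simpl; [reflexivity|]. now rewrite IH, Hside. }
    split; [destruct Hu; lra|].
    split; [apply Rinv_0_lt_compat; destruct Hu; lra|].
    split; [apply (contraction a (Psi a) r Hu Hr)|].
    split; [rewrite <- Hser; apply kneading_series_zero, Hu|].
    destruct (kneading_series_lower_bound a (Psi a) Hu) as (K & HK & Hlow).
    exists K; split; auto. intros t Ht. rewrite <- Hser. now apply Hlow. }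
  pose proof (zero_curve_C1 r a1 a2 (fun a => / Psi a) Hr Hcurve) as HC1.
  (* [Psi] is the reciprocal of [tau = / Psi], hence the derivative [- tau' / tau^2]. *)
  assert (Hder : forall a, a1 < a < a2 ->
     is_derive Psi a (- zero_slope r a a (/ Psi a) (/ Psi a) / (/ Psi a) ^ 2)).
  { intros a Haa. destruct (HC1 a Haa) as [Hd _].
    apply (is_derive_ext (fun x => / / Psi x)); [intros; apply Rinv_inv|].
    apply (is_derive_inv (fun x => / Psi x)); [apply is_derive_Reals, Hd|].
    destruct (Hcurve a Haa) as (_ & ? & _). lra. }
  exists (fun a => - zero_slope r a a (/ Psi a) (/ Psi a) / (/ Psi a) ^ 2).
  split; intros a Haa.
  - apply is_derive_Reals, Hder, Haa.
  - apply continuity_pt_filterlim. destruct (HC1 a Haa) as [Hd Hc].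
    destruct (Hcurve a Haa) as (_ & Hpos & _).
    apply (continuous_mult (fun x => - zero_slope r x x (/ Psi x) (/ Psi x))
             (fun x => / (/ Psi x) ^ 2)).
    + now apply (continuous_opp (fun x => zero_slope r x x (/ Psi x) (/ Psi x))).
    + assert (Hct : continuous (fun x => / Psi x) a).
      { apply (ex_derive_continuous (fun x => / Psi x)).
        eexists. apply is_derive_Reals, Hd. }
      apply continuous_Rinv_comp; [|apply pow_nonzero; lra].
      simpl. apply (continuous_mult (fun x => / Psi x) (fun x => / Psi x * 1)); auto.
      apply (continuous_mult (fun x => / Psi x) (fun _ => 1)); auto.
      apply continuous_const.
Qed.
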